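(* Assume the energy density $F$ satisfies $F(s)\ge0$ for $s\ge0$ and $\lim_{s\to0}F(\frac1s)s=\infty$. Let $n\ge1$ and let $\boldsymbol x^{n-1},\boldsymbol x^{n}\in E_{ad}$ be given. Then there exists a solution $\boldsymbol x^{n+1}=(x^{n+1},y^{n+1})\in E_{ad}$ to the nonlinear scheme $$ \begin{aligned} &\rho_{ij}^0D_2x_{ij}^{n+1}-\varepsilon\tau_{n+1}\Delta_{\boldsymbol X}(x_{ij}^{n+1}-x_{ij}^{n})+\frac{\delta\tilde E_{h,2}}{\delta x}(\boldsymbol x_{ij}^{n+1})=0,\\ &\rho_{ij}^0D_2y_{ij}^{n+1}-\varepsilon\tau_{n+1}\Delta_{\boldsymbol X}(y_{ij}^{n+1}-y_{ij}^{n})+\frac{\delta\tilde E_{h,2}}{\delta y}(\boldsymbol x_{ij}^{n+1})=0, \end{aligned} $$ with the Dirichlet boundary condition $\boldsymbol x^{n+1}|_{\partial\Omega}=\boldsymbol X|_{\partial\Omega}$, and the following energy dissipation law holds under the condition that the time-step ratios satisfy $0<r_{k}\le r_{\max}\le\frac54$ for all $k$: $$ \begin{aligned} &E_{h,2}(\boldsymbol x^{n+1})+\sum_{i,j}\frac{r_{\max}^3}{\tau_{n+1}(1+r_{\max})(1+2r_{\max})}\rho_{ij}^0|\boldsymbol x_{ij}^{n+1}-\boldsymbol x_{ij}^{n}|^2h_xh_y\\ &\le E_{h,2}(\boldsymbol x^{n})+\sum_{i,j}\frac{r_{\max}^3}{\tau_{n}(1+r_{\max})(1+2r_{\max})}\rho_{ij}^0|\boldsymbol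 x_{ij}^{n}-\boldsymbol x_{ij}^{n-1}|^2h_xh_y. \end{aligned} $$
   Context: This is a fully discrete Lagrangian scheme for a two-dimensional Wasserstein gradient flow with energy $E(\rho)=\int_\Omega F(\rho)\,\mathrm{d}\boldsymbol x$. Domain $\Omega=[-L_x,L_x]\times[-L_y,L_y]$, $M_x,M_y\in\mathbb N$, $h_x=2L_x/M_x$, $h_y=2L_y/M_y$; grid points $\boldsymbol X_{ij}=(X_{ij},Y_{ij})$, $X_{ij}=-L_x+jh_x$, $Y_{ij}=-L_y+ih_y$ for $0\le j\le M_x$, $0\le i\le M_y$; $\rho_{ij}^0=\rho(X_{ij},Y_{ij},0)\ge0$ is the initial density at the grid points; $\varepsilon\ge0$ is a small constant. A grid map is $\boldsymbol x_{ij}=(x_{ij},y_{ij})$; its discrete Jacobian determinant (at interior nodes) is $$\det\frac{\partial\boldsymbol x}{\partial\boldsymbol X}\Big|_{ij}=\frac{x_{i,j+1}-x_{i,j-1}}{2h_x}\cdot\frac{y_{i+1,j}-y_{i-1,j}}{2h_y}-\frac{y_{i,j+1}-y_{i,j-1}}{2h_x}\cdot\frac{x_{i+1,j}-x_{i-1,j}}{2h_y}.$$ Admissible set: $E_{ad}=\{\boldsymbol x:\det\frac{\partial\boldsymbol x}{\partial\boldsymbol X}|_{ij}>0\ \text{for all } i,j,\ \boldsymbol x|_{\partial\Omega}=\boldsymbol X|_{\partial\Omega}\}$. Energies: $$\tilde E_{h,2}(\boldsymbol x)=\sum_{i,j}F\Big(\frac{\rho_{ij}^0}{\det\frac{\partial\boldsymbol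 x}{\partial\boldsymbol X}|_{ij}}\Big)\det\frac{\partial\boldsymbol x}{\partial\boldsymbol X}\Big|_{ij},\qquad E_{h,2}(\boldsymbol x)=\tilde E_{h,2}(\boldsymbol x)h_xh_y,$$ (sums over the interior nodes) and $\frac{\delta\tilde E_{h,2}}{\delta x}(\boldsymbol x_{ij})$, $\frac{\delta\tilde E_{h,2}}{\delta y}(\boldsymbol x_{ij})$ are the partial derivatives of $\tilde E_{h,2}$ with respect to $x_{ij}$, $y_{ij}$. The operator $\Delta_{\boldsymbol X}$ is the standard five-point discrete Laplacian on the grid, and $$D_2a^{n+1}=\frac{(1+2r_{n+1})a^{n+1}-(1+r_{n+1})^2a^n+r_{n+1}^2a^{n-1}}{\tau_{n+1}(1+r_{n+1})}.$$ Time steps $\tau_k=t^k-t^{k-1}>0$, $r_{k+1}=\tau_{k+1}/\tau_k$. The scheme is solved in $E_{ad}$ and its solution is understood as the minimizer over $E_{ad}$ of $$ \begin{aligned} J_{n+1}(\boldsymbol x)=\ &E_{h,2}(\boldsymbol x)+\sum_{i,j}\frac{1+2r_{n+1}}{2\tau_{n+1}(1+r_{n+1})}\rho_{ij}^0|\boldsymbol x_{ij}-\hat{\boldsymbol x}_{ij}^{n}|^2h_xh_y\\ &+\frac{\varepsilon\tau_{n+1}}{2}\sum_{i,j}\left(\Big|\frac{\boldsymbol x_{i,j+1}-\boldsymbol x_{i,j+1}^n-\boldsymbol x_{i,j}+\boldsymbol x_{i,j}^n}{h_x}\Big|^2+\Big|\frac{\boldsymbol x_{i+1,j}-\boldsymbol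 x_{i+1,j}^n-\boldsymbol x_{i,j}+\boldsymbol x_{i,j}^n}{h_y}\Big|^2\right)h_xh_y, \end{aligned} $$ where $\hat{\boldsymbol x}^{n}=\frac{(1+r_{n+1})^2}{1+2r_{n+1}}\boldsymbol x^{n}-\frac{r_{n+1}^2}{1+2r_{n+1}}\boldsymbol x^{n-1}$. The function $F$ is assumed differentiable as needed, and $s\to0$ is from the right.
   Formalization: Existence of a solution is proved only when the initial density is strictly positive at every interior node, since with density merely nonnegative existence can fail (e.g. F(s)=s², one interior node of zero density); the energy law keeps nonnegative density. *)

(* Defs.v *)
From mathcomp Require Import all_boot all_order all_algebra.
From mathcomp Require Import all_classical all_reals all_analysis.

Set Implicit Arguments.
Unset Strict Implicit.
Unset Printing Implicit Defensive.

Import Order.TTheory GRing.Theory Num.Theory.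
Import numFieldNormedType.Exports.

Local Open Scope classical_set_scope.
Local Open Scope ring_scope.

(* The rectangle [-Lx, Lx] x [-Ly, Ly] divided into Mx x My cells.  In all
   indexed quantities the first index i belongs to the y-direction and the
   second index j to the x-direction. *)
Record grid (R : realType) := Grid { Lx : R; Ly : R; Mx : nat; My : nat }.

Definition hx (R : realType) (G : grid R) : R := 2 * Lx G / (Mx G)%:R.
Definition hy (R : realType) (G : grid R) : R := 2 * Ly G / (My G)%:R.

Definition Xnode (R : realType) (G : grid R) (j : nat) : R :=
  - Lx G + j%:R * hx G.
Definition Ynode (R : realType) (G : grid R) (i : nat) : R :=
  - Ly G + i%:R * hy G.

Definition interior_node (R : realType) (G : grid R) (i j : nat) : bool :=
  (0 < i < My G)%N && (0 < j < Mx G)%N.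

Definition boundary_node (R : realType) (G : grid R) (i j : nat) : bool :=
  [&& (i <= My G)%N, (j <= Mx G)%N &
      [|| i == 0%N, i == My G, j == 0%N | j == Mx G]].

Notation gridfun R G := 'M[R]_((My G).+1, (Mx G).+1).

(* A grid map is the pair (x, y) of its components. *)
Notation gridmap R G := (gridfun R G * gridfun R G)%type.

(* Only used at nodes i <= My, j <= Mx, where inord does not truncate. *)
Definition at_node (R : realType) (G : grid R) (u : gridfun R G)
  (i j : nat) : R := u (inord i) (inord j).

Definition sqnorm (R : realType) (G : grid R) (x : gridmap R G)
    (i j : nat) : R :=
  at_node x.1 i j ^+ 2 + at_node x.2 i j ^+ 2.

Definition central_dx (R : realType) (G : grid R) (u : gridfun R G)
    (i j : nat) : R :=
  (at_node u i j.+1 - at_node u i j.-1) / (2 * hx G).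

Definition central_dy (R : realType) (G : grid R) (u : gridfun R G)
    (i j : nat) : R :=
  (at_node u i.+1 j - at_node u i.-1 j) / (2 * hy G).

Definition jac (R : realType) (G : grid R) (x : gridmap R G) (i j : nat) : R :=
  central_dx x.1 i j * central_dy x.2 i j - central_dx x.2 i j * central_dy x.1 i j.

Definition Ead (R : realType) (G : grid R) : set (gridmap R G) :=
  [set x | (forall i j, interior_node G i j -> 0 < jac x i j) /\
           (forall i j, boundary_node G i j ->
              at_node x.1 i j = Xnode G j /\ at_node x.2 i j = Ynode G i)].

Arguments Ead {R} G _.

(* Nodal values of the initial density rho = rho(., ., 0). *)
Definition rho0 (R : realType) (G : grid R) (rho : R -> R -> R)
  (i j : nat) : R := rho (Xnode G j) (Ynode G i).

Definition sum_interior (R : realType) (G : grid R) (f : nat -> nat -> R) : R :=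
  \sum_(1 <= i < My G) \sum_(1 <= j < Mx G) f i j.

Definition Etilde (R : realType) (G : grid R) (F : R -> R) (rho : R -> R -> R)
    (x : gridmap R G) : R :=
  sum_interior G (fun i j => F (rho0 G rho i j / jac x i j) * jac x i j).

Definition Eh (R : realType) (G : grid R) (F : R -> R) (rho : R -> R -> R)
    (x : gridmap R G) : R :=
  Etilde F rho x * hx G * hy G.

Definition dEtilde_dx (R : realType) (G : grid R) (F : R -> R)
    (rho : R -> R -> R) (x : gridmap R G) (i j : nat) : R :=
  'D_(delta_mx (inord i) (inord j), 0) (@Etilde R G F rho) x.

Definition dEtilde_dy (R : realType) (G : grid R) (F : R -> R)
    (rho : R -> R -> R) (x : gridmap R G) (i j : nat) : R :=
  'D_(0, delta_mx (inord i) (inord j)) (@Etilde R G F rho) x.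

Definition discrete_laplacian (R : realType) (G : grid R) (u : gridfun R G)
    (i j : nat) : R :=
  (at_node u i j.+1 - 2 * at_node u i j + at_node u i j.-1) / hx G ^+ 2 +
  (at_node u i.+1 j - 2 * at_node u i j + at_node u i.-1 j) / hy G ^+ 2.

(* tau is meaningful for k >= 1 and step_ratio for k >= 2. *)
Definition tau (R : realType) (t : nat -> R) (k : nat) : R := t k - t k.-1.
Definition step_ratio (R : realType) (t : nat -> R) (k : nat) : R :=
  tau t k / tau t k.-1.

(* D2 t n a b c is D_2 a^{n+1} for the levels a = a^{n+1}, b = a^n,
   c = a^{n-1}. *)
Definition D2 (R : realType) (t : nat -> R) (n : nat) (a b c : R) : R :=
  let r := step_ratio t n.+1 in
  ((1 + 2 * r) * a - (1 + r) ^+ 2 * b + r ^+ 2 * c) / (tau t n.+1 * (1 + r)).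

(* In the next definitions xn, xp are the maps at the levels n and n-1. *)
Definition xhat (R : realType) (G : grid R) (t : nat -> R) (n : nat)
    (xn xp : gridmap R G) : gridmap R G :=
  let r := step_ratio t n.+1 in
  ((1 + r) ^+ 2 / (1 + 2 * r)) *: xn - (r ^+ 2 / (1 + 2 * r)) *: xp.

(* The last sum runs over all nodes having both a right and an upper
   neighbour.  The edges it omits lie on the boundary, where x - xn vanishes
   for x, xn in Ead, so its variation is the five-point Laplacian. *)
Definition J (R : realType) (G : grid R) (F : R -> R) (rho : R -> R -> R)
    (eps : R) (t : nat -> R) (n : nat) (xn xp x : gridmap R G) : R :=
  let r := step_ratio t n.+1 in
  Eh F rho x
  + sum_interior G (fun i j =>
      (1 + 2 * r) / (2 * tau t n.+1 * (1 + r)) * rho0 G rho i j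
      * sqnorm (x - xhat t n xn xp) i j * hx G * hy G)
  + eps * tau t n.+1 / 2 *
    \sum_(0 <= i < My G) \sum_(0 <= j < Mx G)
      (((at_node x.1 i j.+1 - at_node xn.1 i j.+1
           - at_node x.1 i j + at_node xn.1 i j) / hx G) ^+ 2
       + ((at_node x.2 i j.+1 - at_node xn.2 i j.+1
           - at_node x.2 i j + at_node xn.2 i j) / hx G) ^+ 2
       + (((at_node x.1 i.+1 j - at_node xn.1 i.+1 j
           - at_node x.1 i j + at_node xn.1 i j) / hy G) ^+ 2
       + ((at_node x.2 i.+1 j - at_node xn.2 i.+1 j
           - at_node x.2 i j + at_node xn.2 i j) / hy G) ^+ 2))
    * hx G * hy G.

Definition scheme (R : realType) (G : grid R) (F : R -> R) (rho : R -> R -> R)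
    (eps : R) (t : nat -> R) (n : nat) (xn xp x : gridmap R G) : Prop :=
  forall i j, interior_node G i j ->
    rho0 G rho i j
      * D2 t n (at_node x.1 i j) (at_node xn.1 i j) (at_node xp.1 i j)
    - eps * tau t n.+1 * discrete_laplacian (x.1 - xn.1) i j
    + dEtilde_dx F rho x i j = 0
    /\
    rho0 G rho i j
      * D2 t n (at_node x.2 i j) (at_node xn.2 i j) (at_node xp.2 i j)
    - eps * tau t n.+1 * discrete_laplacian (x.2 - xn.2) i j
    + dEtilde_dy F rho x i j = 0.

(* The scheme is solved in Ead (which contains the Dirichlet condition), and
   its solution is the minimizer of J over Ead. *)
Definition solution (R : realType) (G : grid R) (F : R -> R)
    (rho : R -> R -> R) (eps : R) (t : nat -> R) (n : nat)
    (xn xp x : gridmap R G) : Prop :=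
  [/\ Ead G x,
      scheme F rho eps t n xn xp x &
      forall z : gridmap R G, Ead G z ->
        J F rho eps t n xn xp x <= J F rho eps t n xn xp z].

(* E_h(x) + sum rm^3 / (tau_k (1+rm) (1+2rm)) rho^0 |x - x'|^2 hx hy, for x,
   x' the maps at the levels k and k-1. *)
Definition modified_energy (R : realType) (G : grid R) (F : R -> R)
    (rho : R -> R -> R) (t : nat -> R) (k : nat) (rm : R)
    (x x' : gridmap R G) : R :=
  Eh F rho x
  + sum_interior G (fun i j =>
      rm ^+ 3 / (tau t k * (1 + rm) * (1 + 2 * rm)) * rho0 G rho i j
      * sqnorm (x - x') i j * hx G * hy G).

(* Main.v *)
Require Import Defs.
From mathcomp Require Import all_boot all_order all_algebra.
From mathcomp Require Import all_classical all_reals all_analysis.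
From mathcomp Require Import ring lra zify.
Import Order.TTheory GRing.Theory Num.Theory.
Import numFieldNormedType.Exports.
Local Open Scope classical_set_scope.
Local Open Scope ring_scope.

Set Implicit Arguments.
Unset Strict Implicit.
Unset Printing Implicit Defensive.

(** Existence is the direct method.  Every summand of [J] is nonnegative on
    [Ead], so a bound on [J] bounds each of them separately.  The inertia term,
    whose weights are positive because the density is, then confines every
    interior node to a bounded set.  The energy term bounds [F (rho / a) * a],
    [a] being the Jacobian at a node, and the growth of [s |-> F (1 / s) * s]
    at 0 turns this into a positive lower bound on [a].  Hence the sublevel set
    of [J] at [xn] lies in a compact subset of [Ead] on which [J] is continuous
    ([sublevel_bounded], [sublevel_jac]), and a minimizer over that compact set
    minimizes over all of [Ead] ([exists_minimizer]).

    [Ead] is open apart from its boundary values, so the derivative of [J] at a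
    minimizer vanishes in every direction that is zero at the boundary nodes
    ([derive_J_minimizer]).  Taking the direction that moves a single
    coordinate of a single interior node gives the scheme
    ([minimizer_scheme]): summation by parts turns the viscous term into the
    five-point Laplacian ([dirichlet_form_delta]), and the inertia term gives
    the BDF2 quotient because [xhat] completes the square ([D2_xhat]).

    For the dissipation law, compare a minimizer [x] with the competitor [xn],
    at which the viscous term is zero.  With [a] and [b] the increments
    [x - xn] and [xn - xp], and [r] the time-step ratio, one has
    [x - xhat = a - r^2 / (1 + 2 r) b] and [xn - xhat = - r^2 / (1 + 2 r) b],
    so the terms in [b^2] cancel in the difference of the two inertia terms and
    the law reduces, node by node and coordinate by coordinate, to the
    positivity of a quadratic form in [(a, b)].  This is
    [dissipation_quadratic_form]; the bound 5/4 on the ratio enters there. *)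

(** * Calculus *)

Lemma derive_local_min (R : realType) (V : normedModType R) (f : V -> R)
    (x v : V) :
  derivable f x v -> (\forall s \near (0 : R), f x <= f (s *: v + x)) ->
  'D_v f x = 0.
Proof.
move=> df fmin; apply/eqP; rewrite eq_le; apply/andP; split.
- apply: (@cvgr_to_le _ (0^'-) _ _ _ _ _ (cvg_dnbhs_at_left df)).
  near=> s; rewrite /= mulr_le0_ge0 ?invr_le0 ?subr_ge0//.
  by near: s; apply: cvg_at_left_filter fmin.
- apply: (@cvgr_to_ge _ (0^'+) _ _ _ _ _ (cvg_dnbhs_at_right df)).
  near=> s; rewrite /= mulr_ge0 ?invr_ge0 ?subr_ge0//.
  by near: s; apply: cvg_at_right_filter fmin.
Unshelve. all: by end_near. Qed.

(** The quadratic terms of [J] are differentiated by expanding them along a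
    line, which makes the algebra a finite computation inside the sums. *)
Lemma is_derive_quadratic (R : realType) (V : normedModType R) (f : V -> R)
    (x v : V) (B C : R) :
  (forall s : R, f (s *: v + x) = f x + s * B + s ^+ 2 * C) ->
  is_derive x v f B.
Proof.
move=> fE.
suff lim : (fun h : R => h^-1 *: ((f \o shift x) (h *: v) - f x)) @ 0^' --> B.
  by apply: DeriveDef; [apply/cvg_ex; exists B|apply: cvg_lim lim].
have : (fun h : R => B + h * C) @ 0^' --> B + 0 * C.
  apply: cvg_within_filter; apply: cvgD; first exact: cvg_cst.
  by apply: cvgM; [exact: cvg_id|exact: cvg_cst].
rewrite mul0r addr0.
apply: cvg_trans; apply: near_eq_cvg; near=> h.
have h0 : h != 0 by near: h; exact: nbhs_dnbhs_neq.
rewrite /= fE; set y := (X in _ *: X).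
by rewrite -[_ *: _]/(h^-1 * y) /y; field.
Unshelve. all: by end_near. Qed.

(** Reshaping a row vector into a matrix is continuous, so this reduces to
    compactness of a product of segments.  The bound depends on the entry, which
    spares taking a maximum over the nodes later. *)
Lemma compact_mx_box (R : realType) m n (M : 'I_m -> 'I_n -> R) :
  compact [set A : 'M[R]_(m, n) | forall i j, `|A i j| <= M i j].
Proof.
pose w := mxvec (\matrix_(i, j) M i j) : 'rV[R]_(m * n).
pose I k : set R := `[- w ord0 k, w ord0 k]%classic.
pose box := [set u : 'rV[R]_(m * n) | forall k, I k (u ord0 k)].
have -> : [set A : 'M[R]_(m, n) | forall i j, `|A i j| <= M i j] =
    vec_mx @` box.
  apply/seteqP; split => [A AM|_ [u ub <-] i j].
    exists (mxvec A); last exact: mxvecK.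
    move=> k; case/mxvec_indexP: k => i j.
    by rewrite /I/w/= !mxvecE mxE in_itv/= -ler_norml.
  have := ub (mxvec_index i j).
  by rewrite /I/w/= mxvecE [vec_mx _ _ _]mxE mxE in_itv/= -ler_norml.
apply: continuous_compact; last first.
  by apply: (@rV_compact R _ I) => k; exact: segment_compact.
apply: continuous_subspaceT => u A [P uP PA].
have : \forall v \near u, forall ij : 'I_m * 'I_n,
    P ij.1 ij.2 (vec_mx v ij.1 ij.2).
  have H := @filter_forall _ _ (fun (ij : 'I_m * 'I_n) (v : 'rV[R]_(m * n)) =>
    P ij.1 ij.2 (vec_mx v ij.1 ij.2)) (nbhs u) _.
  apply: H => -[i j] /=; have := uP i j; rewrite [vec_mx u i j]mxE => uPij.
  have := @coord_continuous R 1 (m * n) ord0 (mxvec_index i j) u _ uPij.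
  by move=> C; apply: (filterS _ (C : nbhs u _)) => v /=;
    rewrite [vec_mx v i j]mxE.
by apply: filterS => v vP; apply: PA => i j; exact: (vP (i, j)).
Qed.

(** * Differentiability of the functional *)

Lemma differentiable_sqr (R : realType) (V : normedModType R) (f : V -> R)
    (x : V) :
  differentiable f x -> differentiable (fun y => f y ^+ 2) x.
Proof.
by move=> df; under eq_fun do rewrite expr2; exact: differentiableM.
Qed.

Lemma differentiable_sum_nat (R : realType) (V : normedModType R)
    (f : nat -> V -> R) (a b : nat) (x : V) :
  (forall i, (a <= i < b)%N -> differentiable (f i) x) ->
  differentiable (fun y => \sum_(a <= i < b) f i y) x.
Proof.
move=> df; have [ba|ab] := leqP b a.
  have -> : (fun y => \sum_(a <= i < b) f i y) = cst 0.
    by apply/funext => y; rewrite big_geq.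
  exact: differentiable_cst.
elim: b ab df => // b IH; rewrite ltnS leq_eqVlt => /predU1P[<-|ab] df.
  under eq_fun do rewrite big_nat1; apply: df; rewrite leqnn ltnSn//.
under eq_fun do rewrite big_nat_recr ?(ltnW ab)//=.
apply: differentiableD; last by apply: df; rewrite (ltnW ab) ltnSn.
by apply: IH => // i /andP[ai ib]; apply: df; rewrite ai ltnS ltnW.
Qed.

Lemma differentiable_sum_interior (R : realType) (G : grid R)
    (V : normedModType R) (f : nat -> nat -> V -> R) (x : V) :
  (forall i j, interior_node G i j -> differentiable (f i j) x) ->
  differentiable (fun y => sum_interior G (fun i j => f i j y)) x.
Proof.
move=> df; apply: differentiable_sum_nat => i iM.
by apply: differentiable_sum_nat => j jM; apply: df; exact/andP.
Qed.

Lemma differentiable_at_node1 (R : realType) (G : grid R) (i j : nat)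
    (x : gridmap R G) :
  differentiable (fun y : gridmap R G => at_node y.1 i j) x.
Proof.
apply: (@differentiable_comp _ _ _ _ fst
  (fun u : gridfun R G => u (inord i) (inord j))).
  by apply: linear_differentiable => z; exact: cvg_fst.
exact: differentiable_coord.
Qed.

Lemma differentiable_at_node2 (R : realType) (G : grid R) (i j : nat)
    (x : gridmap R G) :
  differentiable (fun y : gridmap R G => at_node y.2 i j) x.
Proof.
apply: (@differentiable_comp _ _ _ _ snd
  (fun u : gridfun R G => u (inord i) (inord j))).
  by apply: linear_differentiable => z; exact: cvg_snd.
exact: differentiable_coord.
Qed.

Lemma differentiable_jac (R : realType) (G : grid R) (i j : nat)
    (x : gridmap R G) :
  differentiable (fun y : gridmap R G => jac y i j) x.
Proof.
have cst_diff (c : R) : differentiable (fun _ : gridmap R G => c) x.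
  exact: differentiable_cst.
have d1 i' j' := @differentiable_at_node1 R G i' j' x.
have d2 i' j' := @differentiable_at_node2 R G i' j' x.
rewrite /jac /central_dx /central_dy.
by apply: differentiableB; apply: differentiableM; apply: differentiableM => //;
  apply: differentiableB.
Qed.

(** [F] is only known to be derivable on the positive reals, which is why the
    density has to be positive: at a node of zero density the argument of [F]
    would be 0. *)
Lemma differentiable_Etilde (R : realType) (G : grid R) (F : R -> R)
    (rho : R -> R -> R) (x : gridmap R G) :
  (forall s : R, 0 < s -> derivable F s 1) ->
  (forall i j, interior_node G i j -> 0 < rho0 G rho i j) ->
  (forall i j, interior_node G i j -> 0 < jac x i j) ->
  differentiable (@Etilde R G F rho) x.
Proof.
move=> dF rho_gt0 jac_gt0; apply: differentiable_sum_interior => i j ij.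
have dj := @differentiable_jac R G i j x.
apply: differentiableM => //.
apply: (@differentiable_comp _ _ _ _ (fun y => rho0 G rho i j / jac y i j)).
  apply: differentiableM; first exact: differentiable_cst.
  by apply: differentiableV => //; rewrite gt_eqF ?jac_gt0.
by apply/derivable1_diffP/dF; rewrite divr_gt0 ?rho_gt0 ?jac_gt0.
Qed.

(** The second and third summands of [J], written exactly as there so that the
    splitting of [J] holds by conversion; [w] stands for [xhat]. *)
Definition inertia {R : realType} {G : grid R} (rho : R -> R -> R)
    (t : nat -> R) (n : nat) (w x : gridmap R G) : R :=
  let r := step_ratio t n.+1 in
  sum_interior G (fun i j =>
      (1 + 2 * r) / (2 * tau t n.+1 * (1 + r)) * rho0 G rho i j
      * sqnorm (x - w) i j * hx G * hy G).

Definition viscosity {R : realType} {G : grid R}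
    (eps : R) (t : nat -> R) (n : nat) (xn x : gridmap R G) : R :=
  eps * tau t n.+1 / 2 *
    \sum_(0 <= i < My G) \sum_(0 <= j < Mx G)
      (((at_node x.1 i j.+1 - at_node xn.1 i j.+1
           - at_node x.1 i j + at_node xn.1 i j) / hx G) ^+ 2
       + ((at_node x.2 i j.+1 - at_node xn.2 i j.+1
           - at_node x.2 i j + at_node xn.2 i j) / hx G) ^+ 2
       + (((at_node x.1 i.+1 j - at_node xn.1 i.+1 j
           - at_node x.1 i j + at_node xn.1 i j) / hy G) ^+ 2
       + ((at_node x.2 i.+1 j - at_node xn.2 i.+1 j
           - at_node x.2 i j + at_node xn.2 i j) / hy G) ^+ 2))
    * hx G * hy G.

Lemma J_split (R : realType) (G : grid R) (F : R -> R) (rho : R -> R -> R)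
    (eps : R) (t : nat -> R) (n : nat) (xn xp x : gridmap R G) :
  J F rho eps t n xn xp x = Eh F rho x + inertia rho t n (xhat t n xn xp) x
    + viscosity eps t n xn x.
Proof. by []. Qed.

Lemma at_nodeD (R : realType) (G : grid R) (u v : gridfun R G) i j :
  at_node (u + v) i j = at_node u i j + at_node v i j.
Proof. by rewrite /at_node mxE. Qed.

Lemma at_nodeN (R : realType) (G : grid R) (u : gridfun R G) i j :
  at_node (- u) i j = - at_node u i j.
Proof. by rewrite /at_node mxE. Qed.

Lemma at_nodeZ (R : realType) (G : grid R) (u : gridfun R G) (c : R) i j :
  at_node (c *: u) i j = c * at_node u i j.
Proof. by rewrite /at_node mxE. Qed.

Lemma differentiable_J (R : realType) (G : grid R) (F : R -> R)
    (rho : R -> R -> R) (eps : R) (t : nat -> R) (n : nat)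
    (xn xp x : gridmap R G) :
  (forall s : R, 0 < s -> derivable F s 1) ->
  (forall i j, interior_node G i j -> 0 < rho0 G rho i j) ->
  (forall i j, interior_node G i j -> 0 < jac x i j) ->
  differentiable (J F rho eps t n xn xp) x.
Proof.
move=> dF rho_gt0 jac_gt0.
have cst_diff (c : R) : differentiable (fun _ : gridmap R G => c) x.
  exact: differentiable_cst.
have d1 i' j' := @differentiable_at_node1 R G i' j' x.
have d2 i' j' := @differentiable_at_node2 R G i' j' x.
apply: differentiableD; first apply: differentiableD.
- by do 2![apply: differentiableM => //]; exact: differentiable_Etilde.
- apply: differentiable_sum_interior => i j ij.
  do 2![apply: differentiableM; last exact: cst_diff].
  apply: differentiableM; first exact: cst_diff.
  rewrite /sqnorm /=.
  by apply: differentiableD; apply: differentiable_sqr;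
    under eq_fun do rewrite at_nodeD; apply: differentiableD.
- apply: differentiableM => //.
  apply: differentiable_sum_nat => i _; apply: differentiable_sum_nat => j _.
  do 2![apply: differentiableM => //].
  by repeat apply: differentiableD; apply: differentiable_sqr;
    apply: differentiableM => //; apply: differentiableD => //;
    apply: differentiableB => //; apply: differentiableB.
Qed.

(** * The quadratic form behind the dissipation law *)

(** [dissipation_coef rm / tau_k] is the weight of the squared increment in the
    modified energy. *)
Definition dissipation_coef {R : realType} (r : R) : R :=
  r ^+ 3 / ((1 + r) * (1 + 2 * r)).

Lemma dissipation_coef_gt0 (R : realType) (r : R) :
  0 < r -> 0 < dissipation_coef r.
Proof.
by move=> r0; rewrite divr_gt0 ?exprn_gt0// mulr_gt0// addr_gt0 ?mulr_gt0.
Qed.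

Lemma dissipation_coef_le (R : realType) (r s : R) :
  0 < r -> r <= s -> dissipation_coef r <= dissipation_coef s.
Proof.
move=> r0 rs; have s0 : 0 < s by lra.
rewrite /dissipation_coef ler_pdivrMr; last by nra.
rewrite mulrAC ler_pdivlMr; last by nra.
have p (n : nat) : r ^+ n <= s ^+ n.
  by rewrite lerXn2r ?nnegrE ?(ltW r0) ?(ltW s0).
have p2 : r ^+ 2 * (r * s) <= s ^+ 2 * (r * s).
  by apply: ler_wpM2r; [exact/ltW/mulr_gt0|exact: p].
have p3 : r * (r * s) ^+ 2 <= s * (r * s) ^+ 2 by rewrite ler_wpM2r ?sqr_ge0.
have p1 := p 3; nra.
Qed.

(** This is what restricts the ratio to 5/4: equality holds at the root of
    [4 r^3 = (1 + r) (1 + 2 r)], which is only slightly larger. *)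
Lemma dissipation_coef_quarter (R : realType) (r : R) :
  0 < r -> r <= 5 / 4 -> dissipation_coef r <= 1 / 4.
Proof.
move=> r0 r54; rewrite /dissipation_coef ler_pdivrMr; last by nra.
have : r ^+ 2 * r <= r ^+ 2 * (5 / 4) by rewrite ler_wpM2l ?sqr_ge0.
nra.
Qed.

(** With [K] the coefficient at [s], [A = (1 + 2 r) / (2 (1 + r))] and
    [B = r^2 / (1 + r)], the claim is that [(A - K) a^2 - B a b + K r b^2] is
    nonnegative, that is, [B^2 <= 4 K r (A - K)].  As [A / 2 >= 1 / 4], both the
    coefficient [k] at [r] and [K] lie where [K |-> K (A - K)] is increasing, so
    it suffices to treat [s = r]; there the inequality reads
    [4 r^3 <= (1 + 2 r)^2]. *)
Lemma dissipation_quadratic_form (R : realType) (r s a b : R) :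
  0 < r -> r <= s -> s <= 5 / 4 ->
  dissipation_coef s * a ^+ 2 - dissipation_coef s * r * b ^+ 2 <=
  (1 + 2 * r) / (2 * (1 + r)) * a ^+ 2 - r ^+ 2 / (1 + r) * (a * b).
Proof.
move=> r0 rs s54.
have kK := dissipation_coef_le r0 rs.
have K4 : dissipation_coef s <= 1 / 4 by apply: dissipation_coef_quarter; lra.
have k0 := dissipation_coef_gt0 r0.
set K := dissipation_coef s in kK K4 *.
set k := dissipation_coef r in kK k0 *.
have K0 : 0 < K by lra.
set A := (1 + 2 * r) / (2 * (1 + r)).
set B := r ^+ 2 / (1 + r).
have A2 : 1 / 2 <= A by rewrite /A ler_pdivlMr; lra.
have r1 : 1 + r != 0 by lra.
have r2 : 1 + 2 * r != 0 by lra.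
have disc : B ^+ 2 <= 4 * K * r * (A - K).
  apply: (@le_trans _ _ (4 * k * r * (A - k))); last first.
    have -> : 4 * k * r * (A - k) = (k * (A - k)) * (4 * r) by ring.
    have -> : 4 * K * r * (A - K) = (K * (A - K)) * (4 * r) by ring.
    by rewrite ler_wpM2r//; nra.
  rewrite -subr_ge0.
  have -> : 4 * k * r * (A - k) - B ^+ 2 =
      r ^+ 4 / ((1 + r) * (1 + 2 * r)) ^+ 2 * ((1 + 2 * r) ^+ 2 - 4 * r ^+ 3).
    by rewrite /k /A /B /dissipation_coef; field; rewrite r1 r2.
  have r54 : r <= 5 / 4 by lra.
  have r3 : r ^+ 2 * r <= r ^+ 2 * (5 / 4) by rewrite ler_wpM2l ?sqr_ge0.
  apply: mulr_ge0; first by apply: divr_ge0; apply: exprn_ge0; nra.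
  nra.
(* Multiplying by 4 K r completes the square in b. *)
rewrite -subr_ge0 -(pmulr_rge0 _ (_ : 0 < 4 * K * r)); last first.
  by do 2!apply: mulr_gt0 => //; rewrite mulr_gt0.
have -> : 4 * K * r * (A * a ^+ 2 - B * (a * b) - (K * a ^+ 2 - K * r * b ^+ 2))
   = (2 * K * r * b - B * a) ^+ 2 + (4 * K * r * (A - K) - B ^+ 2) * a ^+ 2.
  by ring.
by rewrite addr_ge0 ?sqr_ge0// mulr_ge0 ?sqr_ge0// subr_ge0.
Qed.

(** * Energy dissipation *)

Lemma ler_sum_interior (R : realType) (G : grid R) (f g : nat -> nat -> R) :
  (forall i j, interior_node G i j -> f i j <= g i j) ->
  sum_interior G f <= sum_interior G g.
Proof.
move=> fg; rewrite /sum_interior !big_nat; apply: ler_sum => i iM.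
by rewrite !big_nat; apply: ler_sum => j jM; apply: fg; exact/andP.
Qed.

Lemma sum_interiorD (R : realType) (G : grid R) (f g : nat -> nat -> R) :
  sum_interior G (fun i j => f i j + g i j) =
  sum_interior G f + sum_interior G g.
Proof.
by rewrite /sum_interior -big_split; apply: eq_bigr => i _; rewrite -big_split.
Qed.

Lemma sum_interiorZ (R : realType) (G : grid R) (c : R) (f : nat -> nat -> R) :
  sum_interior G (fun i j => c * f i j) = c * sum_interior G f.
Proof.
by rewrite /sum_interior mulr_sumr; apply: eq_bigr => i _; rewrite mulr_sumr.
Qed.

Lemma interior_node_le (R : realType) (G : grid R) i j :
  interior_node G i j -> (i <= My G)%N /\ (j <= Mx G)%N.
Proof. by case/andP => /andP[_ /ltnW iM] /andP[_ /ltnW jM]. Qed.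

Lemma hx_gt0 (R : realType) (G : grid R) :
  0 < Lx G -> (0 < Mx G)%N -> 0 < hx G.
Proof. by move=> L M; rewrite divr_gt0 ?mulr_gt0 ?ltr0n. Qed.

Lemma hy_gt0 (R : realType) (G : grid R) :
  0 < Ly G -> (0 < My G)%N -> 0 < hy G.
Proof. by move=> L M; rewrite divr_gt0 ?mulr_gt0 ?ltr0n. Qed.

Lemma viscosity_ge0 (R : realType) (G : grid R) (eps : R) (t : nat -> R)
    (n : nat) (xn x : gridmap R G) :
  0 < hx G -> 0 < hy G -> 0 <= eps -> 0 < tau t n.+1 ->
  0 <= viscosity eps t n xn x.
Proof.
move=> hx0 hy0 eps0 tau0.
rewrite /viscosity mulr_ge0 ?mulr_ge0 ?(ltW tau0)//.
rewrite sumr_ge0// => i _; rewrite sumr_ge0// => j _.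
apply: mulr_ge0 (ltW hy0); apply: mulr_ge0 (ltW hx0).
by repeat apply: addr_ge0; exact: sqr_ge0.
Qed.

Lemma viscosity_id (R : realType) (G : grid R) (eps : R) (t : nat -> R)
    (n : nat) (xn : gridmap R G) :
  viscosity eps t n xn xn = 0.
Proof.
rewrite /viscosity big1 ?mulr0// => i _; rewrite big1// => j _.
have z (a b : R) : a - a - b + b = 0 by ring.
by rewrite !z !mul0r !expr0n/= !addr0 !mul0r.
Qed.

(** Holds because [(1 + r)^2 = (1 + 2 r) + r^2]: the predictor extrapolates
    [xn] by a multiple of the last increment. *)
Lemma sub_xhat (R : realType) (G : grid R) (t : nat -> R) (n : nat)
    (xn xp x : gridmap R G) (r := step_ratio t n.+1) :
  1 + 2 * r != 0 ->
  x - xhat t n xn xp = (x - xn) - (r ^+ 2 / (1 + 2 * r)) *: (xn - xp).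
Proof.
move=> r2; rewrite /xhat -/r.
have -> : (1 + r) ^+ 2 / (1 + 2 * r) = 1 + r ^+ 2 / (1 + 2 * r) by field.
by rewrite scalerDl scale1r scalerBr !opprD !opprK !addrA.
Qed.

(** With the increments [a] in [x] and [b] in [xn], the claimed inequality at
    a node is [rho h_x h_y / tau_{n+1}] times [dissipation_quadratic_form],
    once for each coordinate of the map. *)
Lemma energy_dissipation (R : realType) (G : grid R) (F : R -> R)
    (rho : R -> R -> R) (eps : R) (t : nat -> R) (n : nat)
    (xp xn x : gridmap R G) (rm : R) :
  0 < hx G -> 0 < hy G -> 0 <= eps ->
  (forall i j, interior_node G i j -> 0 <= rho0 G rho i j) ->
  0 < tau t n -> 0 < tau t n.+1 ->
  step_ratio t n.+1 <= rm -> rm <= 5 / 4 ->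
  J F rho eps t n xn xp x <= J F rho eps t n xn xp xn ->
  modified_energy F rho t n.+1 rm x xn <= modified_energy F rho t n rm xn xp.
Proof.
move=> hx0 hy0 eps0 rho0_ge0 tn tn1 rrm rm54.
rewrite !J_split viscosity_id addr0 /modified_energy => Jle.
have := viscosity_ge0 xn x hx0 hy0 eps0 tn1.
set K1 := sum_interior _ _; set K0 := sum_interior _ _.
move: Jle; set V := viscosity _ _ _ _ _.
set I1 := inertia _ _ _ _ _; set I0 := inertia _ _ _ _ _ => Jle V0.
suff H : K1 + I0 <= K0 + I1 by lra.
set r := step_ratio t n.+1 in rrm.
have r0 : 0 < r by exact: divr_gt0.
rewrite /K1 /K0 /I0 /I1 /inertia -!sum_interiorD; apply: ler_sum_interior.
move=> i j ij; rewrite -/r !sub_xhat; try by rewrite -/r; lra.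
rewrite -/r subrr sub0r.
have [rho_ge0 hh] : 0 <= rho0 G rho i j /\ 0 <= hx G * hy G.
  by split; [exact: rho0_ge0|rewrite mulr_ge0 ?ltW].
rewrite /sqnorm /= !(at_nodeD, at_nodeN, at_nodeZ).
set a1 := _ - at_node xn.1 i j; set a2 := _ - at_node xn.2 i j.
set b1 := _ - at_node xp.1 i j; set b2 := _ - at_node xp.2 i j.
(* Expressing tau_n through tau_{n+1} leaves 1 / tau_{n+1} as a common
   factor of all terms. *)
have tE : tau t n = tau t n.+1 / r.
  by rewrite /r /step_ratio /=; field; rewrite !gt_eqF.
have Q1 := dissipation_quadratic_form a1 b1 r0 rrm rm54.
have Q2 := dissipation_quadratic_form a2 b2 r0 rrm rm54.
rewrite -subr_ge0.
set T := tau t n.+1 in tn1 tE *.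
rewrite tE.
have [r1 r2 r3] : [/\ 1 + r != 0, 1 + 2 * r != 0 & r != 0] by split; lra.
have [m1 m2] : 1 + rm != 0 /\ 1 + 2 * rm != 0 by split; lra.
have T0 : T != 0 by rewrite gt_eqF.
have -> : rm ^+ 3 / (T / r * (1 + rm) * (1 + 2 * rm)) =
    dissipation_coef rm * r / T.
  by rewrite /dissipation_coef; field; rewrite m1 m2 r3 T0.
have -> : rm ^+ 3 / (T * (1 + rm) * (1 + 2 * rm)) = dissipation_coef rm / T.
  by rewrite /dissipation_coef; field; rewrite m1 m2 T0.
set K := dissipation_coef rm in Q1 Q2 *.
set lhs := (X in 0 <= X).
have -> : lhs = rho0 G rho i j / T * (hx G * hy G) *
  (((1 + 2 * r) / (2 * (1 + r)) * a1 ^+ 2 - r ^+ 2 / (1 + r) * (a1 * b1)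
     - (K * a1 ^+ 2 - K * r * b1 ^+ 2))
  + ((1 + 2 * r) / (2 * (1 + r)) * a2 ^+ 2 - r ^+ 2 / (1 + r) * (a2 * b2)
     - (K * a2 ^+ 2 - K * r * b2 ^+ 2))).
  by rewrite /lhs; field; rewrite r1 r2 T0.
apply: mulr_ge0; first by apply: mulr_ge0 => //; rewrite divr_ge0 ?(ltW tn1).
by apply: addr_ge0; rewrite subr_ge0.
Qed.

(** * The quadratic forms and their variations *)

Definition mass_form (R : realType) (G : grid R) (m : nat -> nat -> R)
    (u w : gridfun R G) : R :=
  sum_interior G (fun i j => m i j * (at_node u i j * at_node w i j)).

Definition dirichlet_form (R : realType) (G : grid R) (u w : gridfun R G) : R :=
  \sum_(0 <= i < My G) \sum_(0 <= j < Mx G)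
    ((at_node u i j.+1 - at_node u i j) * (at_node w i j.+1 - at_node w i j)
       / hx G ^+ 2
     + (at_node u i.+1 j - at_node u i j) * (at_node w i.+1 j - at_node w i j)
       / hy G ^+ 2).

Lemma mass_form_line (R : realType) (G : grid R) (m : nat -> nat -> R)
    (u w : gridfun R G) (s : R) :
  mass_form m (s *: w + u) (s *: w + u) =
  mass_form m u u + s * (2 * mass_form m u w) + s ^+ 2 * mass_form m w w.
Proof.
rewrite /mass_form mulrA -!sum_interiorZ -!sum_interiorD.
apply: eq_bigr => i _; apply: eq_bigr => j _.
by rewrite !(at_nodeD, at_nodeZ); ring.
Qed.

Lemma dirichlet_form_line (R : realType) (G : grid R) (u w : gridfun R G)
    (s : R) :
  dirichlet_form (s *: w + u) (s *: w + u) =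
  dirichlet_form u u + s * (2 * dirichlet_form u w)
    + s ^+ 2 * dirichlet_form w w.
Proof.
rewrite /dirichlet_form mulrA !mulr_sumr -!big_split; apply: eq_bigr => i _ /=.
rewrite !mulr_sumr -!big_split; apply: eq_bigr => j _ /=.
by rewrite !(at_nodeD, at_nodeZ); ring.
Qed.

Lemma inertiaE (R : realType) (G : grid R) (rho : R -> R -> R) (t : nat -> R)
    (n : nat) (w x : gridmap R G) (r := step_ratio t n.+1)
    (m := fun i j => (1 + 2 * r) / (2 * tau t n.+1 * (1 + r)) * rho0 G rho i j
                     * hx G * hy G) :
  inertia rho t n w x =
  mass_form m (x.1 - w.1) (x.1 - w.1) + mass_form m (x.2 - w.2) (x.2 - w.2).
Proof.
rewrite /inertia /mass_form -sum_interiorD.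
apply: eq_bigr => i _; apply: eq_bigr => j _.
by rewrite /m /sqnorm /= -/r; ring.
Qed.

Lemma viscosityE (R : realType) (G : grid R) (eps : R) (t : nat -> R)
    (n : nat) (xn x : gridmap R G) :
  viscosity eps t n xn x = eps * tau t n.+1 / 2 * (hx G * hy G) *
  (dirichlet_form (x.1 - xn.1) (x.1 - xn.1)
   + dirichlet_form (x.2 - xn.2) (x.2 - xn.2)).
Proof.
rewrite /viscosity /dirichlet_form -[RHS]mulrA; congr (_ * _).
rewrite -big_split mulr_sumr; apply: eq_bigr => i _ /=.
rewrite -big_split mulr_sumr; apply: eq_bigr => j _ /=.
by rewrite !(at_nodeD, at_nodeN); move: (hx G) (hy G) => h k;
  rewrite !expr_div_n; ring.
Qed.

Lemma is_derive_inertia (R : realType) (G : grid R) (rho : R -> R -> R)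
    (t : nat -> R) (n : nat) (w x v : gridmap R G) (r := step_ratio t n.+1)
    (m := fun i j => (1 + 2 * r) / (2 * tau t n.+1 * (1 + r)) * rho0 G rho i j
                     * hx G * hy G) :
  is_derive x v (inertia rho t n w)
    (2 * (mass_form m (x.1 - w.1) v.1 + mass_form m (x.2 - w.2) v.2)).
Proof.
apply: (@is_derive_quadratic _ _ _ _ _ _ (mass_form m v.1 v.1
                                          + mass_form m v.2 v.2)) => s.
by rewrite !inertiaE -/r -/m /= -!addrA !mass_form_line; ring.
Qed.

Lemma is_derive_viscosity (R : realType) (G : grid R) (eps : R)
    (t : nat -> R) (n : nat) (xn x v : gridmap R G) :
  is_derive x v (viscosity eps t n xn)
    (eps * tau t n.+1 * (hx G * hy G) *
     (dirichlet_form (x.1 - xn.1) v.1 + dirichlet_form (x.2 - xn.2) v.2)).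
Proof.
apply: (@is_derive_quadratic _ _ _ _ _ _ (eps * tau t n.+1 / 2 * (hx G * hy G)
  * (dirichlet_form v.1 v.1 + dirichlet_form v.2 v.2))) => s.
by rewrite !viscosityE /= -!addrA !dirichlet_form_line; field.
Qed.

(** Testing the forms against the indicator of a single node extracts one
    equation of the scheme. *)
Lemma sum_kronecker (R : realType) (f : nat -> nat -> R) a b c d i0 j0 :
  (a <= i0 < b)%N -> (c <= j0 < d)%N ->
  \sum_(a <= i < b) \sum_(c <= j < d) f i j * ((i == i0) && (j == j0))%:R
    = f i0 j0.
Proof.
move=> i0P j0P.
rewrite (bigD1_seq i0) ?mem_index_iota ?iota_uniq//=.
rewrite (bigD1_seq j0) ?mem_index_iota ?iota_uniq//=.
rewrite !eqxx mulr1 !big1 ?addr0// => [i /negPf ->|j /negPf ->].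
  by rewrite big1// => j _; rewrite mulr0.
by rewrite andbF mulr0.
Qed.

Lemma at_node_delta (R : realType) (G : grid R) i0 j0 i j :
  (i0 <= My G)%N -> (j0 <= Mx G)%N -> (i <= My G)%N -> (j <= Mx G)%N ->
  at_node (delta_mx (inord i0) (inord j0) : gridfun R G) i j =
  ((i == i0) && (j == j0))%:R.
Proof.
move=> i0M j0M iM jM.
by rewrite /at_node mxE -!val_eqE /= !inordK ?ltnS.
Qed.

Lemma mass_form_delta (R : realType) (G : grid R) (m : nat -> nat -> R)
    (u : gridfun R G) i0 j0 :
  interior_node G i0 j0 ->
  mass_form m u (delta_mx (inord i0) (inord j0)) = m i0 j0 * at_node u i0 j0.
Proof.
move=> ij0; have [i0M j0M] := interior_node_le ij0; case/andP: ij0 => i0P j0P.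
rewrite -[RHS](@sum_kronecker _ (fun i j => m i j * at_node u i j)
  _ _ _ _ _ _ i0P j0P).
rewrite /mass_form /sum_interior !big_nat; apply: eq_bigr => i /andP[_ /ltnW iM].
rewrite !big_nat; apply: eq_bigr => j /andP[_ /ltnW jM].
by rewrite at_node_delta// mulrA.
Qed.

(** Discrete summation by parts: the indicator of an interior node has nonzero
    differences only along the four edges at that node, and all four occur in
    the sum since each starts at a node with [i < My] and [j < Mx]. *)
Lemma dirichlet_form_delta (R : realType) (G : grid R) (u : gridfun R G) i0 j0 :
  interior_node G i0 j0 ->
  dirichlet_form u (delta_mx (inord i0) (inord j0)) =
  - discrete_laplacian u i0 j0.
Proof.
move=> ij0; have [i0M j0M] := interior_node_le ij0.
case/andP: ij0 => /andP[i00 i0P] /andP[j00 j0P].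
pose ux i j := (at_node u i j.+1 - at_node u i j) / hx G ^+ 2.
pose uy i j := (at_node u i.+1 j - at_node u i j) / hy G ^+ 2.
have S f i j := @sum_kronecker R f 0 (My G) 0 (Mx G) i j.
have -> : - discrete_laplacian u i0 j0 =
    ux i0 j0.-1 - ux i0 j0 + (uy i0.-1 j0 - uy i0 j0).
  by rewrite /discrete_laplacian /ux /uy !prednK//; ring.
rewrite -(S ux i0 j0.-1) -?(S ux i0 j0) -?(S uy i0.-1 j0) -?(S uy i0 j0);
  try lia.
rewrite -!sumrB -big_split /dirichlet_form /=.
rewrite !big_nat; apply: eq_bigr => i /andP[_ iM].
rewrite -!sumrB -big_split !big_nat; apply: eq_bigr => j /andP[_ jM] /=.
rewrite !at_node_delta// ?(ltnW iM) ?(ltnW jM)//.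
(* Here 0 < i0 and 0 < j0 matter: the predecessors are genuine. *)
have -> : (j.+1 == j0) = (j == j0.-1) by lia.
have -> : (i.+1 == i0) = (i == i0.-1) by lia.
by rewrite /ux /uy; ring.
Qed.

(** * The Euler-Lagrange equations *)

Lemma mass_form0 (R : realType) (G : grid R) (m : nat -> nat -> R)
    (u : gridfun R G) : mass_form m u 0 = 0.
Proof.
rewrite /mass_form /sum_interior big1// => i _; rewrite big1// => j _.
by rewrite [at_node 0 i j]mxE !mulr0.
Qed.

Lemma dirichlet_form0 (R : realType) (G : grid R) (u : gridfun R G) :
  dirichlet_form u 0 = 0.
Proof.
rewrite /dirichlet_form big1// => i _; rewrite big1// => j _.
by rewrite /at_node !mxE subrr !mulr0 !mul0r addr0.
Qed.

(** The orientation condition is open, being finitely many strict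
    inequalities between continuous functions; the nodes are indexed by ordinals
    to have a finite index type. *)
Lemma near_jac_gt0 (R : realType) (G : grid R) (x : gridmap R G) :
  (forall i j, interior_node G i j -> 0 < jac x i j) ->
  \forall y \near x, forall i j, interior_node G i j -> 0 < jac y i j.
Proof.
move=> jx.
pose P (ij : 'I_(My G).+1 * 'I_(Mx G).+1) (y : gridmap R G) :=
  interior_node G ij.1 ij.2 -> 0 < jac y ij.1 ij.2.
have : \forall y \near x, forall ij, P ij y.
  apply: (@filter_forall _ _ P (nbhs x) _) => -[i j].
  have [ij|nij] := boolP (interior_node G i j); last first.
    by apply: filterE => y; rewrite /P/= (negPf nij).
  have := differentiable_continuous (@differentiable_jac R G i j x).
  move=> /cvgr_gt /(_ _ (jx _ _ ij)).
  by apply: filterS => y yij _.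
apply: filterS => y yP i j ij; have [iM jM] := interior_node_le ij.
by have := yP (inord i, inord j); rewrite /P/= !inordK ?ltnS//; exact.
Qed.

Lemma near_line (R : realType) (V : normedModType R) (x v : V) (P : set V) :
  (\forall y \near x, P y) -> \forall s \near (0 : R), P (s *: v + x).
Proof.
move=> Px.
have : (fun s : R => s *: v + x) @ (0 : R) --> (0 : R) *: v + x.
  apply: cvgD; last exact: cvg_cst.
  exact: scalel_continuous.
by rewrite scale0r add0r; apply.
Qed.

Lemma derive_J_minimizer (R : realType) (G : grid R) (F : R -> R)
    (rho : R -> R -> R) (eps : R) (t : nat -> R) (n : nat)
    (xn xp x v : gridmap R G) :
  (forall s : R, 0 < s -> derivable F s 1) ->
  (forall i j, interior_node G i j -> 0 < rho0 G rho i j) ->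
  Ead G x ->
  (forall z, Ead G z -> J F rho eps t n xn xp x <= J F rho eps t n xn xp z) ->
  (forall i j, boundary_node G i j ->
     at_node v.1 i j = 0 /\ at_node v.2 i j = 0) ->
  'D_v (J F rho eps t n xn xp) x = 0.
Proof.
move=> dF rho_gt0 [jx bx] xmin v0; apply: derive_local_min.
  by apply: diff_derivable; exact: differentiable_J.
have := near_line v (near_jac_gt0 jx); apply: filterS => s js.
apply: xmin; split => // i j ij; have [v1 v2] := v0 i j ij.
have [b1 b2] := bx i j ij.
by rewrite /= !at_nodeD !at_nodeZ v1 v2 b1 b2 !mulr0 !add0r.
Qed.

(** The first variation of [J], term by term; the derivative of the energy
    itself is left unevaluated, as in the scheme. *)
Lemma Euler_Lagrange (R : realType) (G : grid R) (F : R -> R)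
    (rho : R -> R -> R) (eps : R) (t : nat -> R) (n : nat)
    (xn xp x v : gridmap R G) (w := xhat t n xn xp) (r := step_ratio t n.+1)
    (m := fun i j => (1 + 2 * r) / (2 * tau t n.+1 * (1 + r)) * rho0 G rho i j
                     * hx G * hy G) :
  (forall s : R, 0 < s -> derivable F s 1) ->
  (forall i j, interior_node G i j -> 0 < rho0 G rho i j) ->
  Ead G x ->
  (forall z, Ead G z -> J F rho eps t n xn xp x <= J F rho eps t n xn xp z) ->
  (forall i j, boundary_node G i j ->
     at_node v.1 i j = 0 /\ at_node v.2 i j = 0) ->
  'D_v (@Etilde R G F rho) x * hx G * hy G
  + 2 * (mass_form m (x.1 - w.1) v.1 + mass_form m (x.2 - w.2) v.2)
  + eps * tau t n.+1 * (hx G * hy G) *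
     (dirichlet_form (x.1 - xn.1) v.1 + dirichlet_form (x.2 - xn.2) v.2) = 0.
Proof.
move=> dF rho_gt0 xad xmin v0.
rewrite -(derive_J_minimizer dF rho_gt0 xad xmin v0).
have dE : is_derive x v (@Etilde R G F rho) ('D_v (@Etilde R G F rho) x).
  apply/derivableP/diff_derivable/differentiable_Etilde => //.
  by case: xad.
have dEh : is_derive x v (@Eh R G F rho)
    (hx G * hy G * 'D_v (@Etilde R G F rho) x).
  have := is_deriveZ (hx G * hy G) dE.
  have -> : (hx G * hy G) \*: (@Etilde R G F rho) = @Eh R G F rho.
    by apply/funext => y; rewrite /Eh /= -[_ *: _]/(_ * _) mulrC mulrA.
  by [].
have -> : J F rho eps t n xn xp = @Eh R G F rho + inertia rho t n w
    + viscosity eps t n xn by [].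
have d := is_deriveD (is_deriveD dEh (is_derive_inertia rho t n w x v))
  (is_derive_viscosity eps t n xn x v).
by rewrite (@derive_val _ _ _ _ _ _ _ d) -/r -/m; congr (_ + _ + _); ring.
Qed.

(** The right-hand side is the derivative, in the value of [u] at the node, of
    [(1 + 2 r) / (2 tau_{n+1} (1 + r))] times the squared distance to [xhat]. *)
Lemma D2_xhat (R : realType) (G : grid R) (t : nat -> R) (n : nat)
    (u b c : gridfun R G) i j (r := step_ratio t n.+1) :
  0 < r -> tau t n.+1 != 0 ->
  D2 t n (at_node u i j) (at_node b i j) (at_node c i j) =
  (1 + 2 * r) / (tau t n.+1 * (1 + r)) *
  at_node (u - (((1 + r) ^+ 2 / (1 + 2 * r)) *: b - (r ^+ 2 / (1 + 2 * r)) *: c))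
     i j.
Proof.
move=> r0 T0; rewrite /D2 -/r !(at_nodeD, at_nodeN, at_nodeZ).
by field; rewrite T0; apply/and3P; split=> //; lra.
Qed.

Lemma minimizer_scheme (R : realType) (G : grid R) (F : R -> R)
    (rho : R -> R -> R) (eps : R) (t : nat -> R) (n : nat)
    (xn xp x : gridmap R G) :
  0 < hx G -> 0 < hy G -> 0 < tau t n -> 0 < tau t n.+1 ->
  (forall s : R, 0 < s -> derivable F s 1) ->
  (forall i j, interior_node G i j -> 0 < rho0 G rho i j) ->
  Ead G x ->
  (forall z, Ead G z -> J F rho eps t n xn xp x <= J F rho eps t n xn xp z) ->
  scheme F rho eps t n xn xp x.
Proof.
move=> hx0 hy0 tn tn1 dF rho_gt0 xad xmin i j ij.
have r0 : 0 < step_ratio t n.+1 by exact: divr_gt0.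
have T0 : tau t n.+1 != 0 by rewrite gt_eqF.
have [iM jM] := interior_node_le ij.
have hh : hx G * hy G != 0 by apply: lt0r_neq0; exact: mulr_gt0.
have delta0 k l : boundary_node G k l ->
    at_node (delta_mx (inord i) (inord j) : gridfun R G) k l = 0.
  case/and3P => kM lM kl; rewrite at_node_delta//.
  suff -> : (k == i) && (l == j) = false by [].
  apply/negP => /andP[/eqP ki /eqP lj]; move: kl; rewrite ki lj.
  by case/andP: ij => /andP[? ?] /andP[? ?]; lia.
have zero0 k l : at_node (0 : gridfun R G) k l = 0 by rewrite /at_node mxE.
rewrite !(D2_xhat _ _ _ _ _ r0 T0).
(* Each equation of the scheme is the first variation along a nodal
   direction, divided by the cell area. *)
have EL v := @Euler_Lagrange R G F rho eps t n xn xp x v dF rho_gt0 xad xmin.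
split; apply: (mulfI hh); rewrite mulr0.
- rewrite -[RHS](EL (delta_mx (inord i) (inord j), 0)); last first.
    by move=> k l kl /=; rewrite zero0 delta0.
  rewrite /= mass_form0 dirichlet_form0 mass_form_delta// dirichlet_form_delta//.
  rewrite !addr0 /dEtilde_dx.
  by field; rewrite T0 /=; lra.
- rewrite -[RHS](EL (0, delta_mx (inord i) (inord j))); last first.
    by move=> k l kl /=; rewrite zero0 delta0.
  rewrite /= mass_form0 dirichlet_form0 mass_form_delta// dirichlet_form_delta//.
  rewrite !add0r /dEtilde_dy.
  by field; rewrite T0 /=; lra.
Qed.

(** * Existence of a minimizer *)

Lemma sum_interior_ge_term (R : realType) (G : grid R) (f : nat -> nat -> R)
    i0 j0 :
  (forall i j, interior_node G i j -> 0 <= f i j) ->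
  interior_node G i0 j0 -> f i0 j0 <= sum_interior G f.
Proof.
move=> f0 ij0; case/andP: (ij0) => i0P j0P.
rewrite /sum_interior -(@sum_kronecker _ f _ _ _ _ _ _ i0P j0P).
apply: ler_sum_interior => i j /f0 fij.
by case: (_ && _); rewrite ?mulr1 ?mulr0.
Qed.

Lemma Eh_density_ge0 (R : realType) (G : grid R) (F : R -> R)
    (rho : R -> R -> R) (x : gridmap R G) i j :
  (forall s : R, 0 <= s -> 0 <= F s) ->
  (forall i j, interior_node G i j -> 0 <= rho0 G rho i j) ->
  Ead G x -> interior_node G i j ->
  0 <= F (rho0 G rho i j / jac x i j) * jac x i j.
Proof.
move=> F0 rho_ge0 [jx _] ij; have j0 := ltW (jx i j ij).
by rewrite mulr_ge0// F0// divr_ge0// rho_ge0.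
Qed.

(** Rescaling by the density [p]: with [s = a / p], the quantity
    [F (p / a) * a] is [p * (F (1 / s) * s)], which exceeds any bound for small
    [s]. *)
Lemma jac_lower_bound (R : realType) (F : R -> R) (p A : R) :
  F s^-1 * s @[s --> 0^'+] --> +oo -> 0 < p ->
  exists2 d : R, 0 < d & forall a, 0 < a -> F (p / a) * a <= A -> d <= a.
Proof.
move=> /cvgryPgt/(_ (A / p)) [e /= e0 He] p0.
exists (e * p); first exact: mulr_gt0.
move=> a a0; apply: contraTT; rewrite -!ltNge => ae.
have := He (a / p); rewrite /= sub0r normrN gtr0_norm ?divr_gt0// ltr_pdivrMr//.
move=> /(_ ae) /(_ isT); rewrite invf_div.
by rewrite mulrA ltr_pM2r ?invr_gt0.
Qed.

Lemma closed_forall_nodes (R : realType) (V : topologicalType)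
    (P : nat -> nat -> bool) (A : nat -> nat -> set R)
    (f : nat -> nat -> V -> R) :
  (forall i j, continuous (f i j)) -> (forall i j, closed (A i j)) ->
  closed [set z | forall i j, P i j -> A i j (f i j z)].
Proof.
move=> cf cA.
have -> : [set z | forall i j, P i j -> A i j (f i j z)] =
    \bigcap_(p in [set p : nat * nat | P p.1 p.2]) (f p.1 p.2 @^-1` A p.1 p.2).
  apply/seteqP; split => [z zP [i j] /= Pij|z zP i j Pij]; first exact: zP.
  exact: (zP (i, j)).
apply: closed_bigI => -[i j] _; apply: preimage_closed; last exact: cA.
by move=> z _; exact: cf.
Qed.

(** One nonnegative summand of [Eh] is at most [C], so [jac_lower_bound]
    applies at every interior node. *)
Lemma sublevel_jac (R : realType) (G : grid R) (F : R -> R)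
    (rho : R -> R -> R) (C : R) :
  0 < hx G -> 0 < hy G ->
  (forall s : R, 0 <= s -> 0 <= F s) ->
  F s^-1 * s @[s --> 0^'+] --> +oo ->
  (forall i j, interior_node G i j -> 0 < rho0 G rho i j) ->
  exists d : nat -> nat -> R, forall i j, interior_node G i j ->
    0 < d i j /\ forall z, Ead G z -> Eh F rho z <= C -> d i j <= jac z i j.
Proof.
move=> hx0 hy0 F0 Flim rho_gt0.
have rho_ge0 i j : interior_node G i j -> 0 <= rho0 G rho i j.
  by move=> /rho_gt0/ltW.
suff /boolp.choice[d dP] : forall ij : nat * nat, exists d : R,
    interior_node G ij.1 ij.2 ->
    0 < d /\ forall z, Ead G z -> Eh F rho z <= C -> d <= jac z ij.1 ij.2.
  by exists (fun i j => d (i, j)) => i j; exact: (dP (i, j)).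
move=> [i j] /=.
have [ij|_] := boolP (interior_node G i j); last by exists 0.
have [d d0 dP] := jac_lower_bound (C / (hx G * hy G)) Flim (rho_gt0 i j ij).
exists d => _; split => // z zad zC; apply: dP; first by case: zad => + _; exact.
have hh : 0 < hx G * hy G by exact: mulr_gt0.
rewrite ler_pdivlMr//; apply: le_trans zC; rewrite /Eh -[leRHS]mulrA ler_pM2r//.
apply: (@sum_interior_ge_term _ _
  (fun i j => F (rho0 G rho i j / jac z i j) * jac z i j)) => // k l kl.
exact: Eh_density_ge0.
Qed.

(** At an interior node the inertia weight is positive and one summand is at
    most [C]; at a boundary node the Dirichlet condition fixes the value. *)
Lemma sublevel_bounded (R : realType) (G : grid R) (rho : R -> R -> R)
    (t : nat -> R) (n : nat) (w : gridmap R G) (C : R) :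
  0 < hx G -> 0 < hy G -> 0 < tau t n -> 0 < tau t n.+1 ->
  (forall i j, interior_node G i j -> 0 < rho0 G rho i j) ->
  exists M : nat -> nat -> R, forall i j, (i <= My G)%N -> (j <= Mx G)%N ->
    forall z, Ead G z -> inertia rho t n w z <= C ->
      `|at_node z.1 i j| <= M i j /\ `|at_node z.2 i j| <= M i j.
Proof.
move=> hx0 hy0 tn tn1 rho_gt0.
have r0 : 0 < step_ratio t n.+1 by exact: divr_gt0.
suff /boolp.choice[M MP] : forall ij : nat * nat, exists M : R,
    (ij.1 <= My G)%N -> (ij.2 <= Mx G)%N ->
    forall z, Ead G z -> inertia rho t n w z <= C ->
      `|at_node z.1 ij.1 ij.2| <= M /\ `|at_node z.2 ij.1 ij.2| <= M.
  by exists (fun i j => M (i, j)) => i j; exact: (MP (i, j)).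
move=> [i j] /=.
have [ij|nij] := boolP (interior_node G i j); last first.
  exists (`|Xnode G j| + `|Ynode G i|) => iM jM z [_ bz] _.
  have [|-> ->] := bz i j; last by rewrite lerDl lerDr !normr_ge0.
  by apply/and3P; split=> //; move: nij; rewrite /interior_node; lia.
set c := (1 + 2 * step_ratio t n.+1) /
         (2 * tau t n.+1 * (1 + step_ratio t n.+1)).
have c0 : 0 < c by rewrite divr_gt0 ?mulr_gt0//; lra.
pose q := c * rho0 G rho i j * hx G * hy G.
have q0 : 0 < q by do 3![apply: mulr_gt0 => //]; exact: rho_gt0.
exists (1 + C / q + `|at_node w.1 i j| + `|at_node w.2 i j|) => _ _ z zad zC.
have : sqnorm (z - w) i j <= C / q.
  rewrite ler_pdivlMr//; apply: le_trans zC.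
  have -> : sqnorm (z - w) i j * q =
    c * rho0 G rho i j * sqnorm (z - w) i j * hx G * hy G by rewrite /q; ring.
  apply: (@sum_interior_ge_term _ _ (fun i j =>
    c * rho0 G rho i j * sqnorm (z - w) i j * hx G * hy G)) => // k l kl.
  apply: mulr_ge0 (ltW hy0); apply: mulr_ge0 (ltW hx0).
  apply: mulr_ge0; last by rewrite addr_ge0 ?sqr_ge0.
  exact: mulr_ge0 (ltW c0) (ltW (rho_gt0 _ _ kl)).
rewrite /sqnorm /= !at_nodeD !at_nodeN.
set a := at_node z.1 i j; set b := at_node z.2 i j.
set a' := at_node w.1 i j; set b' := at_node w.2 i j => H.
(* A bound linear in K avoids a square root. *)
have sq (u K : R) : u ^+ 2 <= K -> `|u| <= 1 + K.
  by move=> uK; rewrite ler_norml; apply/andP; split; nra.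
have Ha : `|a - a'| <= 1 + C / q by apply: sq; have := sqr_ge0 (b - b'); lra.
have Hb : `|b - b'| <= 1 + C / q by apply: sq; have := sqr_ge0 (a - a'); lra.
have na : `|a| <= `|a - a'| + `|a'| by rewrite -{1}(subrK a' a) ler_normD.
have nb : `|b| <= `|b - b'| + `|b'| by rewrite -{1}(subrK b' b) ler_normD.
by have := normr_ge0 a'; have := normr_ge0 b'; split; lra.
Qed.

Lemma exists_minimizer (R : realType) (G : grid R) (F : R -> R)
    (rho : R -> R -> R) (eps : R) (t : nat -> R) (n : nat)
    (xn xp : gridmap R G) :
  0 < hx G -> 0 < hy G -> 0 <= eps -> 0 < tau t n -> 0 < tau t n.+1 ->
  (forall s : R, 0 < s -> derivable F s 1) ->
  (forall s : R, 0 <= s -> 0 <= F s) ->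
  F s^-1 * s @[s --> 0^'+] --> +oo ->
  (forall i j, interior_node G i j -> 0 < rho0 G rho i j) ->
  Ead G xn ->
  exists2 x : gridmap R G, Ead G x &
    forall z, Ead G z -> J F rho eps t n xn xp x <= J F rho eps t n xn xp z.
Proof.
move=> hx0 hy0 eps0 tn tn1 dF F0 Flim rho_gt0 xn_ad.
have rho_ge0 i j : interior_node G i j -> 0 <= rho0 G rho i j.
  by move=> /rho_gt0/ltW.
have r0 : 0 < step_ratio t n.+1 by exact: divr_gt0.
set Jn := J F rho eps t n xn xp; pose C := Jn xn.
have [d dP] := sublevel_jac C hx0 hy0 F0 Flim rho_gt0.
have [M MP] := sublevel_bounded (xhat t n xn xp) C hx0 hy0 tn tn1 rho_gt0.
pose box := [set A : gridfun R G | forall i j, `|A i j| <= M i j].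
(* The compact set: the strict inequalities defining Ead are replaced by closed
   ones, at a positive distance from degeneration. *)
pose K : set (gridmap R G) := (box `*` box) `&`
  ([set z | forall i j, boundary_node G i j -> at_node z.1 i j = Xnode G j] `&`
   [set z | forall i j, boundary_node G i j -> at_node z.2 i j = Ynode G i] `&`
   [set z | forall i j, interior_node G i j -> d i j <= jac z i j]).
have KE : K `<=` Ead G.
  move=> z [_ [[z1 z2] zd]]; split => i j ij; last by split; [exact: z1|exact: z2].
  by have [d0 _] := dP i j ij; exact: lt_le_trans d0 (zd i j ij).
have SK z : Ead G z -> Jn z <= C -> K z.
  move=> zad; rewrite /Jn J_split => zC.
  have V0 := viscosity_ge0 xn z hx0 hy0 eps0 tn1.
  have I0 : 0 <= inertia rho t n (xhat t n xn xp) z.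
    rewrite /inertia /sum_interior big_nat sumr_ge0// => i iM.
    rewrite big_nat sumr_ge0// => j jM.
    have rij : 0 <= rho0 G rho i j by apply: rho_ge0; exact/andP.
    apply: mulr_ge0 (ltW hy0); apply: mulr_ge0 (ltW hx0).
    apply: mulr_ge0; last by rewrite addr_ge0 ?sqr_ge0.
    apply: mulr_ge0 => //; apply: divr_ge0; first lra.
    by apply: mulr_ge0; lra.
  have E0 : 0 <= Eh F rho z.
    rewrite /Eh; apply: mulr_ge0 (ltW hy0); apply: mulr_ge0 (ltW hx0).
    rewrite /Etilde /sum_interior big_nat sumr_ge0// => i iM.
    rewrite big_nat sumr_ge0// => j jM.
    by apply: Eh_density_ge0 => //; exact/andP.
  have EC : Eh F rho z <= C by lra.
  have IC : inertia rho t n (xhat t n xn xp) z <= C by lra.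
  split; last first.
    have [_ bz] := zad; split; first by split=> i j /bz [].
    by move=> i j /dP [_]; exact.
  have node (u : gridfun R G) (i : 'I_(My G).+1) (j : 'I_(Mx G).+1) :
      u i j = at_node u i j by rewrite /at_node !inord_val.
  by split=> i j; rewrite node; have [] := MP i j (ltn_ord i) (ltn_ord j) z zad IC.
have cK : compact K.
  apply: compact_closedI.
    by apply: compact_setX; exact: compact_mx_box.
  have node1 i j : continuous (fun z : gridmap R G => at_node z.1 i j).
    by move=> z; apply/differentiable_continuous/differentiable_at_node1.
  have node2 i j : continuous (fun z : gridmap R G => at_node z.2 i j).
    by move=> z; apply/differentiable_continuous/differentiable_at_node2.
  apply: closedI; first apply: closedI.
  - apply: (closed_forall_nodes (A := fun i j => [set a | a = Xnode G j])) => //.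
  - apply: (closed_forall_nodes (A := fun i j => [set a | a = Ynode G i])) => //.
  - apply: (closed_forall_nodes (A := fun i j => [set a | d i j <= a])) => //.
    by move=> i j z; apply/differentiable_continuous/differentiable_jac.
have Kn0 : K !=set0 by exists xn; apply: SK.
have cJ : {within K, continuous Jn}.
  apply: continuous_in_subspaceT => z; rewrite inE => /KE [jz _].
  exact/differentiable_continuous/differentiable_J.
have [x xK xmin] := compact_EVT_min Kn0 cK cJ.
move: xK; rewrite inE => xK; exists x; first exact: KE.
move=> z zad; have [zC|/ltW zC] := leP (Jn z) C.
  by apply: xmin; rewrite inE; exact: SK.
by apply: le_trans zC; apply: xmin; rewrite inE; exact: SK.
Qed.

(** * Existence and energy dissipation *)

Theorem theorem4p4 (R : realType) (G : grid R) (F : R -> R)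
    (rho : R -> R -> R) (eps : R) (t : nat -> R) (n : nat)
    (xp xn : gridmap R G)
    (Lx_gt0 : 0 < Lx G) (Ly_gt0 : 0 < Ly G)
    (Mx_gt0 : (0 < Mx G)%N) (My_gt0 : (0 < My G)%N)
    (rho_ge0 : forall i j, (i <= My G)%N -> (j <= Mx G)%N ->
       0 <= rho0 G rho i j)
    (eps_ge0 : 0 <= eps)
    (t_incr : forall k, t k < t k.+1)
    (F_derivable : forall s : R, 0 < s -> derivable F s 1)
    (F_ge0 : forall s : R, 0 <= s -> 0 <= F s)
    (F_lim : F s^-1 * s @[s --> 0^'+] --> +oo)
    (n_ge1 : (1 <= n)%N)
    (xp_ad : Ead G xp) (xn_ad : Ead G xn) :
  ((forall i j, interior_node G i j -> 0 < rho0 G rho i j) ->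
     exists x : gridmap R G, solution F rho eps t n xn xp x)
  /\
  (forall rmax : R, rmax <= 5 / 4 ->
     (forall k, (2 <= k)%N -> 0 < step_ratio t k /\ step_ratio t k <= rmax) ->
     forall x : gridmap R G, solution F rho eps t n xn xp x ->
       modified_energy F rho t n.+1 rmax x xn
       <= modified_energy F rho t n rmax xn xp).
Proof.
have tau_gt0 k : (0 < k)%N -> 0 < tau t k.
  by case: k => // k _; rewrite subr_gt0.
have [tn tn1] : 0 < tau t n /\ 0 < tau t n.+1 by split; exact: tau_gt0.
have [hx0 hy0] : 0 < hx G /\ 0 < hy G by split; [exact: hx_gt0|exact: hy_gt0].
split=> [rho_gt0|rmax rmax54 ratio x [_ _ xmin]].
  have [x xad xmin] := exists_minimizer xp hx0 hy0 eps_ge0 tn tn1 F_derivable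
    F_ge0 F_lim rho_gt0 xn_ad.
  by exists x; split => //; exact: minimizer_scheme.
have [_ rn] := ratio n.+1 n_ge1.
apply: energy_dissipation (xmin xn xn_ad) => // i j /interior_node_le[iM jM].
exact: rho_ge0.
Qed.
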